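(* Let $G=(V,E,\sigma,o)$ be a 1-2 tree and let $\sigma$ be radially symmetric, bounded, and uniformly elliptic. Then $p_c^\sigma=p_c$.
   Context: A weighted rooted tree $G=(V,E,\sigma,o)$ has root $o$ and weights $\sigma:E\to\mathbb{R}_{>0}$. The generation of an edge is the number of edges on the unique path from $o$ ending with it; $e$ is the parent of $e'$ if they are adjacent and $e'$ has generation one more. A proper infinite tree is infinite, locally finite, and every edge has at least one child; it is radially symmetric if the number of children of an edge depends only on its generation; a 1-2 tree is a radially symmetric proper infinite tree in which every edge has one or two children. $\sigma$ is radially symmetric if $\sigma(e)$ depends only on the generation of $e$, and bounded and uniformly elliptic if $\alpha_1\le\sigma\le\alpha_2$ for some constants $0<\alpha_1\le\alpha_2$. A descending path is a path $e_1e_2\cdots$ from $o$ with $e_i$ the parent of $e_{i+1}$; $\Gamma_\infty$ is the set of infinite descending paths. For $\rho:E\to[0,\infty)$, $\ell_\rho(\gamma)=\sum_{e\in\gamma}\rho(e)$; $\mathrm{Adm}(\Gamma_\infty)$ consists of $\rho\ge0$ with $\ell_\rho(\gamma)\ge1$ for all $\gamma\in\Gamma_\infty$. $\mathrm{Mod}_{p,\sigma}(\Gamma_\infty)=\inf_{\rho\in\mathrm{Adm}(\Gamma_\infty)}\sum_e\sigma(e)\rho(e)^p$ and $\mathrm{Mod}_{p,1}$ is the case $\sigma\equiv1$. Critical exponents: $p_c^\sigma=\sup\{p>1:\mathrm{Mod}_{p,\sigma}(\Gamma_\infty)>0\}$ and $p_c=\sup\{p>1:\mathrm{Mod}_{p,1}(\Gamma_\infty)>0\}$,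 each equal to $1$ if the set is empty. *)

(* Defs.v *)
From HB Require Import structures.
From mathcomp Require Import all_boot all_order all_algebra finmap.
From mathcomp Require Import all_classical all_reals all_analysis.

Set Implicit Arguments.
Unset Strict Implicit.
Unset Printing Implicit Defensive.

Import Order.TTheory GRing.Theory Num.Theory.

Local Open Scope classical_set_scope.
Local Open Scope ring_scope.

(* A connected acyclic simple graph with a distinguished vertex. An edge is a
   two-element subset of the vertex type; functions on edges are total functions
   on [{fset vertex G}], of which only the values on [edges G] matter. *)
Record rootedTree := RootedTree {
  vertex : choiceType;
  edges : set {fset vertex};
  root : vertex;
  adjacent : rel vertex := fun u v => [fset u; v]%fset \in edges;
  card_edge : forall e, edges e -> #|` e| = 2%N;
  tree_connected : forall u v, exists2 p, path adjacent u p & last u p = v;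
  tree_acyclic : forall c, ucycle adjacent c -> (size c <= 2)%N
}.

Arguments adjacent : clear implicits.
Arguments edges : clear implicits.
Arguments root : clear implicits.

Section Trees.
Variable G : rootedTree.
Implicit Types (e f : {fset vertex G}) (p : seq (vertex G)).

Definition simple_path (u : vertex G) p := path (adjacent G) u p && uniq (u :: p).

Definition path_edges (u : vertex G) p : seq {fset vertex G} :=
  pairmap (fun v w => [fset v; w]%fset) u p.

Definition generation e : nat :=
  xget 0%N [set n | exists p es,
    [/\ simple_path (root G) p, path_edges (root G) p = rcons es e
      & n = size (rcons es e)]].

Definition edge_adjacent e f := e != f /\ (e `&` f != fset0)%fset.

Definition parent e f :=
  [/\ edges G e, edges G f, edge_adjacent e f & generation f = (generation e).+1].

Definition children e : set {fset vertex G} := [set f | parent e f].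

Definition locally_finite :=
  forall v : vertex G, finite_set [set e | edges G e /\ v \in e].

Definition proper_infinite_tree :=
  [/\ infinite_set [set: vertex G], locally_finite
    & forall e, edges G e -> children e !=set0].

Definition radially_symmetric_tree :=
  forall e f, edges G e -> edges G f -> generation e = generation f ->
    (children e #= children f)%card.

Definition one_two_tree :=
  [/\ proper_infinite_tree, radially_symmetric_tree
    & forall e, edges G e ->
        (children e #= `I_1)%card \/ (children e #= `I_2)%card].

Definition infinite_path_from (u : vertex G) (gamma : nat -> {fset vertex G}) :=
  exists v : nat -> vertex G, [/\ v 0%N = u, injective v,
    forall n, adjacent G (v n) (v n.+1)
    & forall n, gamma n = [fset v n; v n.+1]%fset].

(* The set Gamma_oo of infinite descending paths, as sequences of edges. *)
Definition descending_paths : set (nat -> {fset vertex G}) :=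
  [set gamma | infinite_path_from (root G) gamma /\
               forall n, parent (gamma n) (gamma n.+1)].

End Trees.

Section Modulus.
Variables (R : realType) (G : rootedTree).
Implicit Types (sigma rho : {fset vertex G} -> R) (p : R).

Definition positive_weight sigma := forall e, edges G e -> 0 < sigma e.

Definition radially_symmetric_weight sigma :=
  forall e f, edges G e -> edges G f -> generation e = generation f ->
    sigma e = sigma f.

Definition bounded_uniformly_elliptic sigma :=
  exists alpha1 alpha2 : R, [/\ 0 < alpha1, alpha1 <= alpha2
    & forall e, edges G e -> alpha1 <= sigma e <= alpha2].

Definition path_length rho (gamma : nat -> {fset vertex G}) : \bar R :=
  (\esum_(e in range gamma) (rho e)%:E)%E.

Definition admissible : set ({fset vertex G} -> R) :=
  [set rho | (forall e, edges G e -> 0 <= rho e) /\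
             (forall gamma, descending_paths gamma ->
                (1%:E <= path_length rho gamma)%E)].

Definition energy p sigma rho : \bar R :=
  (\esum_(e in edges G) (sigma e * rho e `^ p)%:E)%E.

Definition modulus p sigma : \bar R :=
  ereal_inf [set energy p sigma rho | rho in admissible].

(* The supremum is taken in the extended reals: it may be +oo. *)
Definition critical_exponent sigma : \bar R :=
  let S := [set p%:E | p in [set p : R | 1 < p /\ (0 < modulus p sigma)%E]] in
  if S == set0 then 1%:E else ereal_sup S.

End Modulus.

(* Main.v *)
(* The modulus is monotone and homogeneous in the weight, so
   [alpha1 Mod_(p,1) <= Mod_(p,sigma) <= alpha2 Mod_(p,1)]: for every [p] the two
   moduli vanish simultaneously, and both critical exponents are computed from the
   same set. *)
Require Import Defs.
From mathcomp Require Import all_boot all_order all_algebra finmap.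
From mathcomp Require Import all_classical all_reals all_analysis.

Import Order.TTheory GRing.Theory Num.Theory.

Local Open Scope classical_set_scope.
Local Open Scope ring_scope.

(** Finite sums of nonnegative terms distribute over [c], and scaling by a positive real commutes
    with the supremum over finite subsets. *)
Lemma ge0_esumZl {R : realType} {T : choiceType} (I : set T) (a : T -> \bar R)
    (c : R) :
  0 < c -> (forall i, (0 <= a i)%E) ->
  (\esum_(i in I) (c%:E * a i) = c%:E * \esum_(i in I) a i)%E.
Proof.
move=> c_gt0 a_ge0; rewrite /esum -ereal_sup_pZl// image_comp; congr ereal_sup.
apply: eq_imagel => A _ /=.
by rewrite ge0_mule_fsumr.
Qed.

Section Modulus.
Context {R : realType} {G : rootedTree}.
Implicit Types (w rho : {fset vertex G} -> R) (c p : R).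

(** Admissibility does not involve the weight, so both infima run over the same [rho]. *)
Lemma modulusZ p c w :
  0 < c -> (forall e, 0 <= w e) ->
  modulus p (fun e => c * w e) = (c%:E * modulus p w)%E.
Proof.
move=> c_gt0 w_ge0; rewrite /modulus -ereal_inf_pZl// image_comp.
congr ereal_inf; apply: eq_imagel => rho _; rewrite /energy /=.
(* [rho] may be negative off the edges, but [powR] is nonnegative at every base. *)
rewrite -ge0_esumZl => [|//|e]; last by rewrite lee_fin mulr_ge0// powR_ge0.
by apply: eq_esum => e _; rewrite -EFinM mulrA.
Qed.

Lemma le_modulus p w1 w2 :
  (forall e, edges G e -> w1 e <= w2 e) -> (modulus p w1 <= modulus p w2)%E.
Proof.
move=> le_w; apply: le_ereal_inf_tmp => _ [rho adm_rho <-].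
apply: ge_ereal_inf; exists (energy p w1 rho); first by exists rho.
by apply: le_esum => e Ge; rewrite lee_fin ler_wpM2r ?powR_ge0 ?le_w.
Qed.

End Modulus.

Theorem theorem15 (R : realType) (G : rootedTree)
    (sigma : {fset vertex G} -> R)
    (sigma_gt0 : positive_weight sigma)
    (G12 : one_two_tree G)
    (sigma_radial : radially_symmetric_weight sigma)
    (sigma_bounded : bounded_uniformly_elliptic sigma) :
  critical_exponent sigma = critical_exponent (fun _ : {fset vertex G} => 1 : R).
Proof.
have [a1 [a2 [a1_gt0 le_a12 sigmaP]]] := sigma_bounded.
have a2_gt0 := lt_le_trans a1_gt0 le_a12.
(* Stated as an equality of booleans, this rewrites under the binder of the set of exponents. *)
suff Mod_gt0 p :
    (0 < modulus p sigma)%E =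
    (0 < modulus p (fun _ : {fset vertex G} => 1%R : R))%E.
  rewrite /critical_exponent.
  by under eq_set do rewrite Mod_gt0.
apply/idP/idP => [Mod_sigma|Mod_1].
(* As [a2] is positive, it suffices that the modulus of the constant weight [a2], which dominates
   [sigma], is positive. *)
- rewrite -(pmule_rgt0 _ (_ : 0 < a2%:E)%E)// -modulusZ//.
  apply: lt_le_trans Mod_sigma _; apply: le_modulus => e /sigmaP/andP[_].
  by rewrite mulr1.
(* The weight is written [a1 * 1] to match the left side of [modulusZ]. *)
- apply: (@lt_le_trans _ _ (modulus p (fun _ : {fset vertex G} => a1 * 1))).
    by rewrite modulusZ//; apply: mule_gt0.
  by apply: le_modulus => e /sigmaP/andP[+ _]; rewrite mulr1.
Qed.
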